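(* Let $n\ge 2$ be an integer. The map $\rho:\mathbb{R}^{n\times n}\to\mathbb{R}^{\binom{n}{2}\times\binom{n}{2}}$ defined by $\rho(A):=A^{[2]}$, where $A^{[2]}$ is the second additive compound of $A$, is a guardian representation.
   Context: Compounds. For $A\in\mathbb{R}^{n\times n}$ and $k\in\{1,\dots,n\}$, the $k$-multiplicative compound $A^{(k)}$ is the $\binom{n}{k}\times\binom{n}{k}$ matrix of all $k$-minors of $A$, where rows and columns are indexed by the $k$-element subsets $i_1<\dots<i_k$ of $\{1,\dots,n\}$ in lexicographic order (the entry indexed by two such subsets is the determinant of the submatrix of $A$ with the corresponding rows and columns). The $k$-additive compound is $A^{[k]}:=\frac{d}{d\varepsilon}(I_n+\varepsilon A)^{(k)}\big|_{\varepsilon=0}$. Lie algebra representations. $\mathrm{gl}(n,\mathbb{R})$ is the Lie algebra of all real $n\times n$ matrices (as a set, $\mathbb{R}^{n\times n}$) with bracket $[A,B]=AB-BA$. A linear map $\rho:\mathrm{gl}(n,\mathbb{R})\to\mathrm{gl}(m,\mathbb{R})$ is a Lie algebra representation if $\rho([A,B])=[\rho(A),\rho(B)]$ for all $A,B\in\mathrm{gl}(n,\mathbb{R})$. Guardian representations. Let $\lambda_1(A),\dots,\lambda_n(A)$ denote the (complex) eigenvalues of $A\in\mathbb{R}^{n\times n}$. Consider the following two conditions on a function $f:\mathbb{R}^{n\times n}\to\mathbb{R}$: (G1) $f(A)\neq 0$ whenever $\mathrm{Re}(\lambda_i(A))<0$ for all $i$, and $f(A)=0$ whenever $\mathrm{Re}(\lambda_i(A))=0$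 for some $i$; (G2) $f(A)\neq 0$ whenever $\mathrm{Re}(\lambda_i(A))<0$ for all $i$, and $f(A)=0$ whenever $A$ has an eigenvalue $\mathrm{i}\beta$ with $\beta\in\mathbb{R}$, $\beta\ne 0$. A map $\rho:\mathrm{gl}(n,\mathbb{R})\to\mathrm{gl}(m,\mathbb{R})$ is a guardian representation if it is a Lie algebra representation and the function $A\mapsto\det(\rho(A))$ satisfies (G1) or (G2). *)

(* Defs.v *)
From HB Require Import structures.
From mathcomp Require Import all_boot all_order all_algebra.
From mathcomp Require Import reals topology normedtype derive.
From mathcomp Require Import complex.

Set Implicit Arguments.
Unset Strict Implicit.
Unset Printing Implicit Defensive.

Import Order.TTheory GRing.Theory Num.Theory.
Import numFieldNormedType.Exports.
Local Open Scope ring_scope.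

(* A k-element subset i_1 < ... < i_k of 'I_n is encoded by the tuple of its
   elements in increasing order. *)
Definition ksubsets (n k : nat) : {set k.-tuplelexi 'I_n} :=
  [set t : k.-tuplelexi 'I_n | sorted ltn (map val t)].

Lemma card_ksubsets (n k : nat) : #|ksubsets n k| = 'C(n, k).
Proof. exact: card_ltn_sorted_tuples. Qed.

(* [Order.enum_val] enumerates in increasing order, which on [k.-tuplelexi 'I_n]
   is the lexicographic order. *)
Definition ksubset (n k : nat) (i : 'I_('C(n, k))) : k.-tuplelexi 'I_n :=
  Order.enum_val (cast_ord (esym (card_ksubsets n k)) i).

Definition mul_compound (R : comNzRingType) (n k : nat) (A : 'M[R]_n) :
    'M[R]_('C(n, k)) :=
  \matrix_(i, j) \det (mxsub (tnth (ksubset i)) (tnth (ksubset j)) A).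

(* The derivative is the one of the normed space of matrices; the function
   being differentiated is polynomial in e, so the limit exists. *)
Definition add_compound (R : realType) (n k : nat) (A : 'M[R]_n) :
    'M[R]_('C(n, k)) :=
  derive1 (fun e : R => mul_compound k (1%:M + e *: A)) 0.

Definition lie_bracket (R : pzRingType) (n : nat) (A B : 'M[R]_n) : 'M[R]_n :=
  A *m B - B *m A.

Definition lie_representation (R : pzRingType) (n m : nat)
    (rho : 'M[R]_n -> 'M[R]_m) : Prop :=
  linear rho /\
  forall A B, rho (lie_bracket A B) = lie_bracket (rho A) (rho B).

Definition complex_eigenvalue (R : rcfType) (n : nat) (A : 'M[R]_n) :
    pred (complex R) :=
  eigenvalue (map_mx (real_complex R) A).

Definition guards_open_left_half_plane (R : rcfType) (n : nat)
    (f : 'M[R]_n -> R) : Prop :=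
  (forall A, (forall l, complex_eigenvalue A l -> complex.Re l < 0) ->
     f A != 0) /\
  (forall A, (exists2 l, complex_eigenvalue A l & complex.Re l = 0) ->
     f A = 0).

Definition guards_nonzero_imaginary (R : rcfType) (n : nat)
    (f : 'M[R]_n -> R) : Prop :=
  (forall A, (forall l, complex_eigenvalue A l -> complex.Re l < 0) ->
     f A != 0) /\
  (forall A, (exists2 b : R, b != 0 & complex_eigenvalue A (Complex 0 b)) ->
     f A = 0).

Definition guardian_representation (R : rcfType) (n m : nat)
    (rho : 'M[R]_n -> 'M[R]_m) : Prop :=
  lie_representation rho /\
  (guards_open_left_half_plane (fun A => \det (rho A)) \/
   guards_nonzero_imaginary (fun A => \det (rho A))).

(* Main.v *)
(* Identify a row vector v indexed by the pairs i < j with the skew-symmetric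
   matrix S having these upper entries.  Right multiplication of v by A^[2] then
   becomes S |-> S A + A^T S, the infinitesimal congruence action, from which
   linearity and the bracket identity are immediate.  So det A^[2] = 0 iff some
   nonzero skew S satisfies S A = - A^T S.  If A is stable, A and - A^T have no
   common eigenvalue, so S = 0 by Sylvester's argument: S p(A) = p(- A^T) S for
   every polynomial p.  If i b is an eigenvalue with left eigenvector x + i y and
   b <> 0, then S = x^T y - y^T x is a nonzero solution; hence (G2). *)
Require Import Defs.
From HB Require Import structures.
From mathcomp Require Import all_boot all_order all_algebra.
From mathcomp Require Import reals.
From mathcomp Require Import classical_sets topology normedtype derive complex.
From mathcomp Require Import ring.

Set Implicit Arguments.
Unset Strict Implicit.
Unset Printing Implicit Defensive.

Import Order.TTheory GRing.Theory Num.Theory.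
Import numFieldNormedType.Exports.
Local Open Scope classical_set_scope.
Local Open Scope ring_scope.

(** * Sylvester's equation [S A = B S] *)

Section Sylvester.
Variable F : fieldType.

Lemma char_poly_tr n (A : 'M[F]_n) : char_poly A^T = char_poly A.
Proof.
rewrite /char_poly -det_tr; congr (\det _).
by rewrite /char_poly_mx linearB /= tr_scalar_mx -map_trmx trmxK.
Qed.

Lemma horner_mx_intertwine n (A B S : 'M[F]_n.+1) (p : {poly F}) :
  S *m A = B *m S -> S *m horner_mx A p = horner_mx B p *m S.
Proof.
move=> SA; elim/poly_ind: p => [|p c IHp]; first by rewrite !rmorph0 mulmx0 mul0mx.
rewrite !rmorphD !rmorphM /= !horner_mx_X !horner_mx_C mulmxDr mulmxDl.
by rewrite mulmxA IHp -!mulmxA SA scalar_mxC.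
Qed.

(** Evaluating a Bezout relation at [A] gives [v(A) chi_B(A) = 1] by Cayley-Hamilton; moving both
    factors across [S] yields [S = v(B) chi_B(B) S = 0]. *)
Lemma sylvester_eq0 n (A B S : 'M[F]_n) :
  coprimep (char_poly A) (char_poly B) -> S *m A = B *m S -> S = 0.
Proof.
case: n A B S => [|n] A B S; first by move=> *; apply/matrixP => -[].
move=> /Bezout_eq1_coprimepP[[u v] /= uv1] SA.
have /(congr1 (horner_mx A)) := uv1.
rewrite rmorphD !rmorphM /= Cayley_Hamilton mulr0 add0r rmorph1 => vA1.
rewrite -[S]mulmx1 -[1%:M]/(1 : 'M[F]_n.+1) -vA1 mulmxA.
rewrite (horner_mx_intertwine v SA) -mulmxA (horner_mx_intertwine _ SA).
by rewrite Cayley_Hamilton mul0mx mulmx0.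
Qed.

End Sylvester.

(** * Two-element subsets as increasing pairs *)

Lemma ksubset_inj n k : injective (@ksubset n k).
Proof. by move=> i j ij; have /cast_ord_inj := Order.enum_val_inj ij. Qed.

Section Pairs.
Variable n : nat.
Implicit Types k l : 'I_('C(n, 2)).

Definition fst_elt k : 'I_n := tnth (ksubset k) ord0.
Definition snd_elt k : 'I_n := tnth (ksubset k) ord_max.

Lemma ksubset_pair k : tval (ksubset k) = [:: fst_elt k; snd_elt k].
Proof.
by rewrite /fst_elt /snd_elt; case: (ksubset k) => -[|a [|b []]].
Qed.

Lemma fst_lt_snd k : (fst_elt k < snd_elt k)%N.
Proof.
have : ksubset k \in ksubsets n 2 by apply: Order.enum_valP.
by rewrite inE ksubset_pair /= andbT.
Qed.

Lemma pair_inj k l : fst_elt k = fst_elt l -> snd_elt k = snd_elt l -> k = l.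
Proof.
move=> e0 e1; apply/ksubset_inj/val_inj.
by rewrite /= !ksubset_pair e0 e1.
Qed.

Lemma pair_surj (a b : 'I_n) : (a < b)%N ->
  exists2 k, fst_elt k = a & snd_elt k = b.
Proof.
move=> lt_ab; pose t : 2.-tuplelexi 'I_n := [tuple a; b].
have tP : t \in ksubsets n 2 by rewrite inE /= lt_ab.
pose k := cast_ord (card_ksubsets n 2) (Order.enum_rank_in tP t).
have kE : ksubset k = t by rewrite /ksubset /k cast_ordK Order.enum_rankK_in.
by exists k; rewrite /fst_elt /snd_elt kE.
Qed.

End Pairs.

(** * Skew-symmetric matrices and infinitesimal congruence *)

Section SkewMatrices.
Variables (R : numFieldType) (n : nat).
Implicit Types (A S T : 'M[R]_n) (v : 'rV[R]_('C(n, 2))) (k l : 'I_('C(n, 2))).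

Lemma skew_ext S T : S^T = - S -> T^T = - T ->
  (forall k, S (fst_elt k) (snd_elt k) = T (fst_elt k) (snd_elt k)) -> S = T.
Proof.
move=> skS skT eST.
have skE (U : 'M[R]_n) : U^T = - U -> forall a b, U a b = - U b a.
  by move=> /matrixP skU a b; have := skU b a; rewrite !mxE.
have diag (U : 'M[R]_n) : U^T = - U -> forall a, U a a = 0.
  move=> skU a; have /eqP := skE U skU a a.
  (* In characteristic zero, [2 U a a = 0] forces [U a a = 0]. *)
  by rewrite -addr_eq0 -mulr2n mulrn_eq0 => /eqP.
apply/matrixP => a b; case: (ltngtP a b) => [/pair_surj[k <- <-] // | ba | /val_inj->].
  by rewrite (skE S) // (skE T) //; case: (pair_surj ba) => k <- <-; rewrite eST.
by rewrite !diag.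
Qed.

Definition skew_basis k : 'M[R]_n :=
  delta_mx (fst_elt k) (snd_elt k) - delta_mx (snd_elt k) (fst_elt k).

Definition skew_of v : 'M[R]_n := \sum_k v 0 k *: skew_basis k.

Lemma skew_of_is_linear : linear skew_of.
Proof.
move=> a u v; rewrite /skew_of scaler_sumr -big_split /=.
by apply: eq_bigr => k _; rewrite !mxE scalerDl scalerA.
Qed.
HB.instance Definition _ :=
  GRing.isLinear.Build R 'rV[R]_('C(n, 2)) 'M[R]_n _ skew_of skew_of_is_linear.

Lemma skew_basisE k l : skew_basis k (fst_elt l) (snd_elt l) = (k == l)%:R.
Proof.
rewrite !mxE; have -> : (fst_elt l == snd_elt k) && (snd_elt l == fst_elt k) = false.
  apply/negP => /andP[/eqP e0 /eqP e1].
  by have := fst_lt_snd k; rewrite -e0 -e1 ltnNge ltnW // fst_lt_snd.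
rewrite subr0; congr (nat_of_bool _)%:R; apply/andP/eqP => [[/eqP e0 /eqP e1] | ->].
  exact: pair_inj.
by rewrite !eqxx.
Qed.

Lemma skew_ofE v l : skew_of v (fst_elt l) (snd_elt l) = v 0 l.
Proof.
rewrite /skew_of summxE (bigD1 l) //= big1 => [|k /negPf kl]; rewrite mxE skew_basisE.
  by rewrite eqxx mulr1 addr0.
by rewrite kl mulr0.
Qed.

Lemma tr_skew_of v : (skew_of v)^T = - skew_of v.
Proof.
rewrite /skew_of linear_sum -sumrN; apply: eq_bigr => k _ /=.
by rewrite linearZ linearB /= !trmx_delta -scalerN opprB.
Qed.

Lemma skew_of_inj : injective skew_of.
Proof. by move=> u v uv; apply/rowP => l; rewrite -!skew_ofE uv. Qed.

Lemma skew_of_surj S : S^T = - S -> exists v, skew_of v = S.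
Proof.
move=> skS; exists (\row_k S (fst_elt k) (snd_elt k)).
by apply: skew_ext; rewrite ?tr_skew_of // => k; rewrite skew_ofE mxE.
Qed.

(* The derivative at [t = 0] of the congruence [S |-> (1 + t A)^T S (1 + t A)]. *)
Definition congr_action A S : 'M[R]_n := S *m A + A^T *m S.

Lemma congr_action_is_linear A : linear (congr_action A).
Proof.
move=> a S T; rewrite /congr_action mulmxDl mulmxDr -scalemxAl -scalemxAr.
by rewrite scalerDr addrACA.
Qed.
HB.instance Definition _ A := GRing.isLinear.Build R 'M[R]_n 'M[R]_n _
  (congr_action A) (congr_action_is_linear A).

Lemma tr_congr_action A S : S^T = - S ->
  (congr_action A S)^T = - congr_action A S.
Proof.
move=> skS; rewrite /congr_action linearD /= !trmx_mul trmxK skS.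
by rewrite mulmxN mulNmx opprD addrC.
Qed.

(** The Kronecker deltas stay explicit factors, so that [ring] can later match them with those in
    the minors of [1 + e A]. *)
Lemma congr_action_basisE A k (a b : 'I_n) :
  congr_action A (skew_basis k) a b =
    (fst_elt k == a)%:R * A (snd_elt k) b + A (fst_elt k) a * (snd_elt k == b)%:R
    - (snd_elt k == a)%:R * A (fst_elt k) b - A (snd_elt k) a * (fst_elt k == b)%:R.
Proof.
have delta_mulE (i j : 'I_n) : (delta_mx i j *m A) a b = (i == a)%:R * A j b.
  rewrite mxE (bigD1 j) //= big1 => [|m /negPf mj]; rewrite !mxE.
    by rewrite eqxx andbT addr0 eq_sym.
  by rewrite mj andbF mul0r.
have mul_deltaE (i j : 'I_n) : (A^T *m delta_mx i j) a b = A i a * (j == b)%:R.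
  rewrite mxE (bigD1 i) //= big1 => [|m /negPf mj]; rewrite !mxE.
    by rewrite eqxx addr0 eq_sym.
  by rewrite mj mulr0.
rewrite /congr_action /skew_basis mulmxBl mulmxBr.
have addE (P Q : 'M[R]_n) : (P + Q) a b = P a b + Q a b by rewrite mxE.
have subE (P Q : 'M[R]_n) : (P - Q) a b = P a b - Q a b by rewrite !mxE.
rewrite addE !subE !delta_mulE !mul_deltaE; ring.
Qed.

End SkewMatrices.

(** * The second additive compound as the action on skew matrices *)

Section AdditiveCompound.
Variables (R : realType) (n : nat).
Implicit Types (A B : 'M[R]_n) (v : 'rV[R]_('C(n, 2))).

Lemma mul_compound2E A i j : mul_compound 2 A i j =
  A (fst_elt i) (fst_elt j) * A (snd_elt i) (snd_elt j) -
  A (fst_elt i) (snd_elt j) * A (snd_elt i) (fst_elt j).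
Proof.
rewrite mxE (expand_det_row _ ord0) !big_ord_recl big_ord0 /cofactor !det_mx11 !mxE.
rewrite /= expr0 expr1 addr0 mul1r mulN1r mulrN /fst_elt /snd_elt.
(* The cofactor expansion produces lifted indices that agree with [ord0] and [ord_max] only by
   value. *)
by do ![congr (_ - _) | congr (_ * _) | congr (A _ _) | congr tnth | apply: val_inj].
Qed.

Definition skew_action A : 'M[R]_('C(n, 2)) :=
  \matrix_(k, l) congr_action A (skew_basis R k) (fst_elt l) (snd_elt l).

(** A 2-minor is quadratic in the entries, so the expansion in [e] stops at degree two. *)
Lemma mul_compound2_taylor A (e : R) :
  mul_compound 2 (1%:M + e *: A) =
    1%:M + e *: skew_action A + e ^+ 2 *: mul_compound 2 A.
Proof.
have entryE (P Q : 'M[R]_('C(n, 2))) i j :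
    (1%:M + e *: P + e ^+ 2 *: Q) i j = (i == j)%:R + e * P i j + e ^+ 2 * Q i j.
  by rewrite !mxE.
apply/matrixP => k l; rewrite entryE !mul_compound2E [skew_action A k l]mxE.
rewrite congr_action_basisE -skew_basisE.
(* The entry of the identity is itself rewritten as a 2-minor of the identity matrix, in the deltas
   used on the other side. *)
have delta_minor :
    skew_basis R k (fst_elt l) (snd_elt l) =
    (fst_elt k == fst_elt l)%:R * (snd_elt k == snd_elt l)%:R
    - (fst_elt k == snd_elt l)%:R * (snd_elt k == fst_elt l)%:R.
  rewrite !mxE -!natrM !mulnb.
  by rewrite ![_ == fst_elt k]eq_sym ![_ == snd_elt k]eq_sym [in X in _ - X]andbC.
rewrite delta_minor !mxE.
ring.
Qed.

(** For [h != 0] the difference quotient at 0 is exactly [B + h C], which tends to [B]. *)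
Lemma add_compound2E A : add_compound 2 A = skew_action A.
Proof.
rewrite /add_compound /derive1; apply: cvg_lim => //.
set B := skew_action A; set C := mul_compound 2 A.
have cvgBC : (B + h *: C) @[h --> 0^'] --> B.
  have {2}-> : B = B + 0 *: C by rewrite scale0r addr0.
  apply: cvgD; first exact: cvg_cst.
  by apply: cvgZr_tmp; exact: nbhs_dnbhs.
apply: cvg_trans cvgBC; apply: near_eq_cvg; near=> h.
have h0 : h != 0 by near: h; exact: nbhs_dnbhs_neq.
rewrite !mul_compound2_taylor addr0 expr0n !scale0r !addr0.
rewrite -[1%:M + _ + _]addrA [1%:M + _]addrC addrK.
by rewrite scalerDr !scalerA expr2 mulrA mulVf // mul1r scale1r.
Unshelve. all: by end_near.
Qed.

Lemma skew_of_add_compound2 A v :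
  skew_of (v *m add_compound 2 A) = congr_action A (skew_of v).
Proof.
apply: skew_ext; rewrite ?tr_congr_action ?tr_skew_of // => l.
rewrite skew_ofE add_compound2E mxE /skew_of linear_sum summxE.
by apply: eq_bigr => k _; rewrite linearZ /= [RHS]mxE [skew_action A k l]mxE.
Qed.

Lemma add_compound2_linear : linear (fun A : 'M[R]_n => add_compound 2 A).
Proof.
(* Only the intertwining relation is kept: it determines [rho], since [skew_of] is injective. *)
move: (@add_compound R n 2) skew_of_add_compound2 => rho rhoE.
move=> a A B; apply/row_matrixP => i; rewrite !rowE; apply: skew_of_inj.
rewrite mulmxDr -scalemxAr linearD linearZ /= !rhoE.
rewrite /congr_action mulmxDr -scalemxAr [_^T]linearD /= [(a *: A)^T]linearZ /=.
rewrite mulmxDl -scalemxAl.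
by rewrite scalerDr addrACA.
Qed.

Lemma add_compound2_bracket A B :
  add_compound 2 (lie_bracket A B) =
  lie_bracket (add_compound 2 A) (add_compound 2 B).
Proof.
move: (@add_compound R n 2) skew_of_add_compound2 => rho rhoE.
apply/row_matrixP => i; rewrite !rowE; apply: skew_of_inj.
set v := delta_mx 0 i; rewrite [in RHS]/lie_bracket mulmxBr !mulmxA linearB /=.
rewrite !rhoE /congr_action /lie_bracket; set S := skew_of v.
rewrite [_^T]linearB /= !trmx_mul !mulmxDl !mulmxDr !mulNmx !mulmxN !mulmxA.
(* With the triple products made opaque, the identity is purely additive: the mixed terms [A^T S B]
   and [B^T S A] cancel. *)
move: (S *m A *m B) (S *m B *m A) (_ *m _ *m S) (_ *m _ *m S).
move: (_ *m _ *m _) (_ *m _ *m _) => a b c d e f.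
apply/matrixP => x y; rewrite !mxE; ring.
Qed.

(** * Condition (G2) for the determinant *)

Lemma det_add_compound2_eq0 A :
  reflect (exists S : 'M[R]_n, [/\ S != 0, S^T = - S & congr_action A S = 0])
          (\det (add_compound 2 A) == 0).
Proof.
apply: (iffP det0P) => [[v v0 vA0] | [S [S0 skS AS0]]].
  exists (skew_of v); rewrite tr_skew_of -skew_of_add_compound2 vA0 linear0.
  by split => //; apply: contra_neq v0 => v0; apply: skew_of_inj; rewrite linear0.
case: (skew_of_surj skS) => v vS; exists v.
  by apply: contra_neq S0 => v0; rewrite -vS v0 linear0.
by apply: skew_of_inj; rewrite skew_of_add_compound2 vS AS0 linear0.
Qed.

Lemma det_add_compound2_stable A :
  (forall l, complex_eigenvalue A l -> complex.Re l < 0) ->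
  \det (add_compound 2 A) != 0.
Proof.
move=> stableA; apply/det_add_compound2_eq0 => -[S [/eqP S0 _ /eqP]].
rewrite addr_eq0 -mulNmx => /eqP SA; apply: S0; apply: sylvester_eq0 SA.
(* Coprimality is unchanged by extension to the complex numbers, where it means having no common
   root. *)
rewrite -(coprimep_map (real_complex R)) !map_char_poly.
apply/Pdiv.ClosedField.coprimepP => l Al; apply/negP; rewrite -/(root _ l).
rewrite -linearN /= -map_trmx char_poly_tr -eigenvalue_root_char.
move: Al; rewrite -eigenvalue_root_char => /stableA l_lt0.
rewrite map_mxN => /eigenvalueP[v vA v0].
(* A common root [l] makes both [l] and [- l] eigenvalues of [A], and their real parts cannot both
   be negative. *)
have /stableA : complex_eigenvalue A (- l).
  by apply/eigenvalueP; exists v => //; rewrite scaleNr -vA mulmxN opprK.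
by case: l l_lt0 {vA} => x y /= x_lt0; rewrite oppr_lt0 ltNge ltW.
Qed.

Lemma imaginary_eigenvectors A (b : R) :
  complex_eigenvalue A (Complex 0 b) ->
  exists x y : 'rV[R]_n,
    [/\ (x != 0) || (y != 0), x *m A = - b *: y & y *m A = b *: x].
Proof.
move=> /eigenvalueP[v vA v0].
exists (map_mx (@complex.Re R) v), (map_mx (@complex.Im R) v); split.
- apply: contraNT v0; rewrite negb_or !negbK => /andP[/eqP/rowP x0 /eqP/rowP y0].
  apply/eqP/rowP => j; have := x0 j; have := y0 j; rewrite !mxE.
  by case: (v 0 j) => p q /= -> ->.
- apply/rowP => j; have /rowP/(_ j)/(congr1 (@complex.Re R)) := vA.
  rewrite !mxE raddf_sum /=; case: (v 0 j) => p q /=; rewrite mul0r sub0r mulNr => <-.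
  by apply: eq_bigr => i _; rewrite !mxE; case: (v 0 i) => ? ? /=; rewrite mulr0 subr0.
- apply/rowP => j; have /rowP/(_ j)/(congr1 (@complex.Im R)) := vA.
  rewrite !mxE raddf_sum /=; case: (v 0 j) => p q /=; rewrite mul0r add0r => <-.
  apply: eq_bigr => i _; rewrite !mxE; case: (v 0 i) => ? ? /=.
  by rewrite mulr0 add0r.
Qed.

(** The diagonal entries are the sums of squares [x_j^2 + y_j^2]. *)
Lemma outer_eq0 (x y : 'rV[R]_n) :
  x^T *m x + y^T *m y = 0 -> x = 0 /\ y = 0.
Proof.
move=> /matrixP xy0; have sq0 j : x 0 j = 0 /\ y 0 j = 0.
  have := xy0 j j; rewrite !mxE !big_ord1 !mxE => /eqP.
  by rewrite -!expr2 paddr_eq0 ?sqr_ge0 // !sqrf_eq0 => /andP[/eqP-> /eqP->].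
by split; apply/rowP => j; rewrite mxE; case: (sq0 j).
Qed.

Lemma det_add_compound2_imaginary A (b : R) : b != 0 ->
  complex_eigenvalue A (Complex 0 b) -> \det (add_compound 2 A) = 0.
Proof.
move=> b0 /imaginary_eigenvectors[x [y [xy0 xA yA]]].
apply/eqP/det_add_compound2_eq0.
pose S := x^T *m y - y^T *m x.
have SA : S *m A = b *: (x^T *m x + y^T *m y).
  by rewrite /S mulmxBl -!mulmxA xA yA -!scalemxAr scaleNr opprK scalerDr.
(* [S] is skew and [S A] is symmetric, so transposing [S A] gives this relation. *)
have AS : A^T *m S = - (S *m A).
  rewrite SA /S mulmxBr !mulmxA -!trmx_mul xA yA !linearZ /= -!scalemxAl.
  by rewrite scaleNr -opprD addrC scalerN scalerDr.
exists S; split.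
(* Independence of [x] and [y] need not be shown first: [S = 0] would kill [x^T x + y^T y], hence
   both vectors. *)
- apply/eqP => S0; move: SA; rewrite S0 mul0mx => /esym/eqP.
  rewrite scaler_eq0 (negPf b0) => /eqP/outer_eq0[x0 y0].
  by move: xy0; rewrite x0 y0 eqxx.
- by rewrite /S linearB /= !trmx_mul !trmxK opprB.
- by rewrite /congr_action AS subrr.
Qed.

End AdditiveCompound.

Theorem proposition1 (R : realType) (n : nat) (hn : (2 <= n)%N) :
  guardian_representation (fun A : 'M[R]_n => add_compound 2 A).
Proof.
split; first by split; [exact: add_compound2_linear | exact: add_compound2_bracket].
(* (G1) fails: [diag(0, -1, ..., -1)] has eigenvalue 0, but its second additive compound has
   eigenvalues only -1 and -2. *)
right; split; first exact: det_add_compound2_stable.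
by move=> A [b b0]; exact: det_add_compound2_imaginary.
Qed.
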